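(* Let $f:\mathbb{R}^n\to\mathbb{R}$ satisfy: (A1) $f$ is continuous and bounded; (A2) $f$ attains its minimum, i.e. with $\underline f:=\min_{z\in\mathbb{R}^n}f(z)$ the set of global minimizers $\mathfrak{M}:=\{x\in\mathbb{R}^n: f(x)=\underline f\}$ is nonempty; (A3) for every $\delta>0$ there exists $\gamma=\gamma(\delta)>0$ such that $\inf\{f(x)-\underline f:\operatorname{dist}(x,\mathfrak{M})>\delta\}>\gamma(\delta)$. Let $y_x^{\alpha_\varepsilon}(\cdot)$ be an $\varepsilon$-optimal trajectory, starting from $x$, for the infinite-horizon discounted problem ($\lambda>0$). Then, when $\varepsilon$ is small, the set of global minimizers $\mathfrak{M}$ is Lyapunov stable, i.e. $$\forall\,\delta>0,\ \exists\,\eta>0\ \text{such that}\ \operatorname{dist}(x,\mathfrak{M})\le\eta\ \Longrightarrow\ \operatorname{dist}\big(y_x^{\alpha_\varepsilon}(s),\mathfrak{M}\big)\le\delta\quad\forall\,s\in(0,\infty).$$ This is in particular satisfied by an optimal trajectory.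
   Context: $\|f\|_\infty=\sup|f|$. Fix a constant $M\ge1+\sqrt{6\|f\|_\infty}$ (which can be taken arbitrarily large) and let $B_M$ be the closed ball of radius $M$ centered at $0$ in $\mathbb{R}^n$. Admissible controls are measurable functions $\alpha(\cdot):[0,\infty)\to B_M$; the trajectory starting from $x\in\mathbb{R}^n$ with control $\alpha$ is $y_x^\alpha(s)=x+\int_0^s\alpha(r)\,dr$. The infinite-horizon discounted problem, with discount $\lambda>0$, has value function $$u_\lambda(x)=\inf_\alpha\int_0^\infty\Big(\tfrac12|\alpha(s)|^2+f(y_x^\alpha(s))\Big)e^{-\lambda s}\,ds.$$ For $\varepsilon>0$, a trajectory $y_x^{\alpha_\varepsilon}$ with admissible control $\alpha_\varepsilon$ is $\varepsilon$-optimal if $\int_0^\infty(\tfrac12|\alpha_\varepsilon(s)|^2+f(y_x^{\alpha_\varepsilon}(s)))e^{-\lambda s}\,ds\le u_\lambda(x)+\varepsilon$; it is optimal if this holds with $\varepsilon=0$. $\operatorname{dist}(y,\mathfrak{M})=\inf_{z\in\mathfrak{M}}|y-z|$.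
   Formalization: For ε>0 the bound is proved for s in (0,T], T arbitrary, with ''ε small'' depending on T (η independent of T and ε), since for fixed ε>0 an ε-optimal trajectory may leave 𝔐 at a late time; for optimal trajectories it holds for all s>0. *)

(* Defs.v *)
From mathcomp Require Import all_boot all_order all_algebra.
From mathcomp Require Import all_classical all_reals all_analysis.
Import Order.TTheory GRing.Theory Num.Theory.
Import numFieldNormedType.Exports.

Set Implicit Arguments.
Unset Strict Implicit.
Unset Printing Implicit Defensive.

Local Open Scope classical_set_scope.
Local Open Scope ring_scope.

(* The norm that the library puts on row vectors is the max norm, hence the
   explicit Euclidean norm. *)
Definition enorm (R : realType) (n : nat) (x : 'rV[R]_n) : R :=
  Num.sqrt (\sum_(i < n) x ord0 i ^+ 2).

Definition dist (R : realType) (n : nat) (y : 'rV[R]_n) (A : set 'rV[R]_n)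
  : R := inf [set enorm (y - z) | z in A].

Definition sup_norm (R : realType) (n : nat) (f : 'rV[R]_n -> R) : R :=
  sup [set `|f x| | x in [set: 'rV[R]_n]].

(* [inf (range f)] is the minimum of [f] as soon as [minimizers f] is
   nonempty and [f] is bounded below. *)
Definition fmin (R : realType) (n : nat) (f : 'rV[R]_n -> R) : R :=
  inf (range f).

Definition minimizers (R : realType) (n : nat) (f : 'rV[R]_n -> R)
  : set 'rV[R]_n := [set x | f x = fmin f].

(* The infimum is taken in the extended reals, so that it is [+oo] when no
   point is at distance more than [delta] from the minimizers. *)
Definition well_separated (R : realType) (n : nat) (f : 'rV[R]_n -> R) : Prop :=
  forall delta : R, 0 < delta -> exists2 gamma : R, 0 < gamma &
    (gamma%:E < ereal_inf [set (f x - fmin f)%:E |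
                  x in [set x | (delta < dist x (minimizers f))%R]])%E.

(* Only the values of a control on [0, +oo[ matter.  Measurability into R^n
   with its Borel sigma-algebra amounts to that of the coordinates. *)
Definition admissible (R : realType) (n : nat) (M : R) (alpha : R -> 'rV[R]_n)
  : Prop :=
  (forall i : 'I_n, measurable_fun (`[0, +oo[ : set (measurableTypeR R))
                      (fun s => alpha s ord0 i)) /\
  (forall s : R, 0 <= s -> enorm (alpha s) <= M).

Definition trajectory (R : realType) (n : nat) (x : 'rV[R]_n)
    (alpha : R -> 'rV[R]_n) (s : R) : 'rV[R]_n :=
  x + \row_i (\int[lebesgue_measure]_(r in `[0, s]) alpha r ord0 i).

(* For an admissible control and a bounded continuous [f] the integrand is
   integrable, so that the real-valued integral is the genuine one. *)
Definition cost (R : realType) (n : nat) (f : 'rV[R]_n -> R) (lambda : R)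
    (x : 'rV[R]_n) (alpha : R -> 'rV[R]_n) : R :=
  \int[lebesgue_measure]_(s in `[0, +oo[)
    ((2^-1 * enorm (alpha s) ^+ 2 + f (trajectory x alpha s))
       * expR (- lambda * s)).

Definition value (R : realType) (n : nat) (f : 'rV[R]_n -> R) (M lambda : R)
    (x : 'rV[R]_n) : R :=
  inf [set cost f lambda x alpha | alpha in admissible M].

Definition eps_optimal (R : realType) (n : nat) (f : 'rV[R]_n -> R)
    (M lambda eps : R) (x : 'rV[R]_n) (alpha : R -> 'rV[R]_n) : Prop :=
  admissible M alpha /\
  cost f lambda x alpha <= value f M lambda x + eps.

Definition optimal (R : realType) (n : nat) (f : 'rV[R]_n -> R)
    (M lambda : R) (x : 'rV[R]_n) (alpha : R -> 'rV[R]_n) : Prop :=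
  eps_optimal f M lambda 0 x alpha.

(* Main.v *)
Require Import Defs.
From mathcomp Require Import all_boot all_order all_algebra.
From mathcomp Require Import all_classical all_reals all_analysis.
From mathcomp Require Import ring lra measurable_realfun.

Set Implicit Arguments.
Unset Strict Implicit.
Unset Printing Implicit Defensive.

Import Order.TTheory GRing.Theory Num.Theory.
Import numFieldNormedType.Exports.

Local Open Scope classical_set_scope.
Local Open Scope ring_scope.

(** Subtract the minimum: [g := f - fmin f] is nonnegative, vanishes on the
    minimizers and stays above a positive constant away from them.  Replacing
    [f] by [g] shifts every cost by the same constant, so near-optimality is
    unaffected.  Write [L] for the running cost of a trajectory [y] for [g],
    [G t] for the part of its cost that is paid after time [t], and
    [E t := exp (lambda * t) * G t] for that part as seen from time [t].

    The quantity [E] serves as a Lyapunov function, for three reasons.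

    - It starts small near the minimizers: a point [x] at distance less than
      [tau] from a minimizer can be moved to it at speed at most 1 within time
      [tau] and then left there for free, so that the optimal cost from [x] is
      at most [tau * (1/2 + K)], where [K] bounds [g]
      ([small_cost_near_zero]).

    - It hardly grows.  An admissible competitor follows the trajectory up to
      time [t] and stays at [y t] for ever; comparison gives
      [G t <= g (y t) * exp (- lambda * t) / lambda + eps]
      ([cost_from_le_halt]).  Since [g (y t) * exp (- lambda * t)] is at most
      [L t = - G' t], this says [(G - eps)' <= - lambda * (G - eps)], whence
      [exp (lambda * t) * (G t - eps)] is nonincreasing.  The argument is
      carried out with finite increments, which avoids differentiating [G] and
      costs a harmless factor 2 ([cost_from_decay], [implicit_euler_decay],
      [discounted_cost_from_le]).

    - It is bounded below away from the minimizers: the speed is at most [M],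
      so a trajectory at distance more than [delta] needs a time proportional
      to [delta] to come within distance [delta / 2], and pays a fixed positive
      amount meanwhile ([cost_from_ge_away]).

    So a trajectory that starts close enough to the minimizers can be at
    distance more than [delta] at time [t] only if the error
    [eps * exp (lambda * t)] is at least a fixed positive constant
    ([near_optimal_confined]).  This is excluded on a bounded time interval
    when [eps] is small, and for all times when [eps = 0]. *)

(** * The Euclidean norm and the distance to a set *)

Section euclidean_norm.
Context {R : realType} {n : nat}.
Implicit Types (x y : 'rV[R]_n) (A : set 'rV[R]_n).

Lemma enorm_ge0 x : 0 <= enorm x. Proof. exact: sqrtr_ge0. Qed.

Lemma sqr_enorm x : enorm x ^+ 2 = \sum_(i < n) x ord0 i ^+ 2.
Proof. by rewrite sqr_sqrtr// sumr_ge0// => i _; exact: sqr_ge0. Qed.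

Lemma enorm0 : enorm (0 : 'rV[R]_n) = 0.
Proof.
by rewrite /enorm big1 ?sqrtr0// => i _; rewrite mxE expr0n.
Qed.

Lemma enormZ a x : enorm (a *: x) = `|a| * enorm x.
Proof.
rewrite /enorm -sqrtr_sqr -sqrtrM ?sqr_ge0//; congr Num.sqrt.
by rewrite mulr_sumr; apply: eq_bigr => i _; rewrite mxE exprMn.
Qed.

Lemma enormN x : enorm (- x) = enorm x.
Proof. by rewrite -scaleN1r enormZ normrN1 mul1r. Qed.

Lemma coord_le_enorm x i : `|x ord0 i| <= enorm x.
Proof.
rewrite -sqrtr_sqr ler_wsqrtr// (bigD1 i)//= lerDl sumr_ge0// => j _.
exact: sqr_ge0.
Qed.

Lemma enorm_eq0 x : enorm x = 0 -> x = 0.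
Proof.
move=> x0; apply/rowP => i; rewrite mxE; apply/eqP.
by rewrite -normr_le0 -x0 coord_le_enorm.
Qed.

(** Convexity of the square gives
    [(a + b)^2 <= (p + q) * (a^2 / p + b^2 / q)]; the norms themselves are the
    weights [p], [q] that make the sum over the coordinates collapse. *)
Lemma enormD x y : enorm (x + y) <= enorm x + enorm y.
Proof.
have [/enorm_eq0 ->|x0] := eqVneq (enorm x) 0.
  by rewrite add0r enorm0 add0r.
have [/enorm_eq0 ->|y0] := eqVneq (enorm y) 0.
  by rewrite addr0 enorm0 addr0.
have px : 0 < enorm x by rewrite lt_def x0 enorm_ge0.
have py : 0 < enorm y by rewrite lt_def y0 enorm_ge0.
rewrite -(@ler_pXn2r _ 2) ?nnegrE ?addr_ge0 ?enorm_ge0//.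
set p := enorm x in x0 px *; set q := enorm y in y0 py *.
have -> : (p + q) ^+ 2 =
    \sum_(i < n) (p + q) * (x ord0 i ^+ 2 / p + y ord0 i ^+ 2 / q).
  rewrite -mulr_sumr big_split/= -!mulr_suml -!sqr_enorm -/p -/q.
  by field; rewrite x0 y0.
rewrite sqr_enorm ler_sum// => i _; rewrite mxE -subr_ge0.
set a := x ord0 i; set b := y ord0 i.
have -> : (p + q) * (a ^+ 2 / p + b ^+ 2 / q) - (a + b) ^+ 2 =
    (q * a - p * b) ^+ 2 / (p * q) by field; rewrite x0 y0.
by rewrite divr_ge0 ?sqr_ge0// mulr_ge0// ltW.
Qed.

(** The constant [n] is not sharp, but only the order of magnitude of the
    displacement of a trajectory matters below. *)
Lemma enorm_le_coord x B : (forall i, `|x ord0 i| <= B) -> enorm x <= n%:R * B.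
Proof.
move=> xB; have [n0|n0] := posnP n.
  rewrite /enorm big1 ?sqrtr0 ?n0 ?mul0r// => i _.
  by have := ltn_ord i; rewrite {2}n0.
have B0 : 0 <= B by exact: le_trans (xB (Ordinal n0)).
rewrite -(@ler_pXn2r _ 2) ?nnegrE ?enorm_ge0 ?mulr_ge0// sqr_enorm exprMn.
apply: (@le_trans _ _ (\sum_(i < n) B ^+ 2)).
  apply: ler_sum => i _; rewrite -(real_normK (num_real (x ord0 i))).
  by rewrite ler_pXn2r ?nnegrE.
rewrite sumr_const card_ord -[leLHS]mulr_natl; apply: ler_wpM2r.
  exact: sqr_ge0.
by rewrite -natrX ler_nat leq_pmulr.
Qed.

Lemma dist_has_inf y A : A !=set0 -> has_inf [set enorm (y - z) | z in A].
Proof.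
move=> [z Az]; split; first by exists (enorm (y - z)), z.
by exists 0 => _ [w _ <-]; exact: enorm_ge0.
Qed.

Lemma le_dist y z A : A z -> dist y A <= enorm (y - z).
Proof.
move=> Az; apply: ge_inf; last by exists z.
by have [] := dist_has_inf y (ex_intro _ _ Az : A !=set0).
Qed.

Lemma dist_lt_ex y A r : A !=set0 -> dist y A < r ->
  exists2 z, A z & enorm (y - z) < r.
Proof.
move=> A0 /(inf_lt (dist_has_inf y A0).1)[_ [z Az <-]] yzr.
by exists z.
Qed.

Lemma dist_le_enormB x y A : A !=set0 -> dist y A <= dist x A + enorm (x - y).
Proof.
move=> A0; apply/ler_addgt0Pr => e e0.
have [z Az xz] := @dist_lt_ex x A (dist x A + e) A0 (ltr_pwDr e0 (lexx _)).
apply: le_trans (le_dist y Az) _.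
have -> : y - z = - (x - y) + (x - z) by rewrite opprB addrA subrK.
by apply: le_trans (enormD _ _) _; rewrite enormN; lra.
Qed.

End euclidean_norm.

(** * The discount factor *)

Section discount.
Context {R : realType}.
Variable lambda : R.
Hypothesis lambda_gt0 : 0 < lambda.
Notation mu := (@lebesgue_measure R).
Let discount (s : R) : R := expR (- lambda * s).

Lemma continuous_discount : continuous discount.
Proof.
move=> z; apply: continuous_comp; last exact: continuous_expR.
by apply: continuousM => //; apply: (@continuousN _ R^o); exact: cst_continuous.
Qed.

Let derive1_discount z :
  (fun x => - expR (- lambda * x))^`()%classic z = lambda * discount z.
Proof.
rewrite derive1_comp// derive1N// derive1_id mulN1r derive1_comp// derive1E.
have /funeqP -> := @derive_expR R.
by rewrite derive1Ml// derive1_id mulr1 mulrN opprK mulrC.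
Qed.

Let integral_discount a :
  (\int[mu]_(s in `[a, +oo[) (lambda * discount s)%:E = (discount a)%:E)%E.
Proof.
rewrite (@ge0_continuous_FTC2y _ _ (fun x => - discount x) _ 0)//.
- by rewrite EFinN oppeK add0e.
- by move=> x _; rewrite mulr_ge0 ?expR_ge0// ltW.
- apply: continuous_subspaceT => x; apply: (@continuousM _ R^o).
    exact: cst_continuous.
  exact: continuous_discount.
- rewrite -oppr0; apply: cvgN.
  rewrite (_ : discount = (fun z => expR (- z)) \o (fun z => lambda * z)).
    apply: (@cvg_comp _ _ _ _ _ _ (pinfty_nbhs R)); last exact: cvgr_expR.
    exact: gt0_cvgMry.
  by apply: eq_fun => x; rewrite mulNr.
- by apply: cvgN; apply/cvg_at_right_filter; exact: continuous_discount.
Qed.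

Lemma integrable_discount a :
  mu.-integrable `[a, +oo[ (EFin \o discount).
Proof.
have mD : measurable_fun (`[a, +oo[ : set R) discount.
  apply: measurable_funTS; apply: continuous_measurable_fun.
  exact: continuous_discount.
have -> : EFin \o discount =
    (fun s => (lambda^-1)%:E * (lambda * discount s)%:E)%E.
  by apply/funext => s /=; rewrite -EFinM mulKf// gt_eqF.
apply: integrableZl => //; apply/integrableP; split.
  by apply/measurable_EFinP; exact: measurable_funM.
under eq_integral => s _.
  by rewrite abse_EFin ger0_norm ?mulr_ge0 ?expR_ge0 ?(ltW lambda_gt0)//; over.
by rewrite integral_discount ltry.
Qed.

Lemma Rintegral_discount a :
  \int[mu]_(s in `[a, +oo[) discount s = discount a / lambda.
Proof.
rewrite [LHS](_ : _ =
    \int[mu]_(s in `[a, +oo[) (lambda^-1 * (lambda * discount s))).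
  rewrite RintegralZl//; last first.
    have := integrable_discount a => /(integrableZl _ lambda); exact.
  by rewrite /Rintegral integral_discount/= mulrC.
by apply: eq_Rintegral => s _; rewrite mulKf// gt_eqF.
Qed.

Lemma integrable_scaled_discount c a :
  mu.-integrable `[a, +oo[ (EFin \o (fun s => c * discount s)).
Proof. exact: integrableZl (integrable_discount a). Qed.

Lemma Rintegral_scaled_discount c a :
  \int[mu]_(s in `[a, +oo[) (c * discount s) = c * (discount a / lambda).
Proof.
by rewrite RintegralZl ?Rintegral_discount//; exact: integrable_discount.
Qed.

End discount.

(** * Trajectories are Lipschitz *)

Section trajectory.
Context {R : realType} {n : nat}.
Variables (M : R) (x : 'rV[R]_n) (alpha : R -> 'rV[R]_n).
Hypothesis adm : admissible M alpha.
Notation mu := (@lebesgue_measure R).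
Let y := trajectory x alpha.

Lemma integrable_control i t :
  mu.-integrable `[0, t] (EFin \o (fun s => alpha s ord0 i)).
Proof.
apply: measurable_bounded_integrable => //.
- by rewrite /= lebesgue_measure_itv/=; case: ifP => _; rewrite -?EFinB ltry.
- by apply: measurable_funS (adm.1 i) => //; exact: subset_itvl.
- exists M; split; first exact: num_real.
  move=> B MB s /=; rewrite in_itv/= => /andP[s0 _].
  apply: le_trans (coord_le_enorm _ i) _.
  exact: le_trans (adm.2 s s0) (ltW MB).
Qed.

Lemma trajectory_le0 s : s <= 0 -> y s = x.
Proof.
rewrite /y/trajectory le_eqVlt => /predU1P[->|s0].
  by apply/rowP => i; rewrite !mxE set_itv1 Rintegral_set1 addr0.
apply/rowP => i; rewrite !mxE set_itv_ge ?bnd_simp -?ltNge//.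
by rewrite Rintegral_set0 addr0.
Qed.

Lemma trajectoryB s t i : 0 <= s <= t ->
  y t ord0 i - y s ord0 i = \int[mu]_(r in `]s, t]) alpha r ord0 i.
Proof.
move=> /andP[s0 st]; rewrite !mxE opprD addrACA subrr add0r.
by rewrite Rintegral_itvB ?bnd_simp//; exact: integrable_control.
Qed.

Let coord_trajectory_lip0 s t i : 0 <= s <= t ->
  `|y t ord0 i - y s ord0 i| <= M * (t - s).
Proof.
move=> st; rewrite trajectoryB//; have /andP[s0 sltt] := st.
have ic : mu.-integrable `]s, t] (EFin \o (fun r => alpha r ord0 i)).
  apply: integrableS (integrable_control i t) => //.
  by apply: subset_itvr; rewrite bnd_simp.
apply: le_trans (le_normr_Rintegral _ ic) _ => //.
have -> : M * (t - s) = \int[mu]_(_ in `]s, t]) M.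
  rewrite Rintegral_cst//= lebesgue_measure_itv/= lte_fin.
  by move: sltt; rewrite le_eqVlt => /predU1P[->|->]//=; rewrite ltxx subrr.
apply: le_Rintegral => //.
- exact: integrable_norm.
- apply: measurable_bounded_integrable => //.
    by rewrite /= lebesgue_measure_itv/=; case: ifP => _; rewrite -?EFinB ltry.
  exact: bounded_cst.
- move=> r /=; rewrite in_itv/= => /andP[sr _].
  apply: le_trans (coord_le_enorm _ i) (adm.2 r _).
  by rewrite (le_trans s0)// ltW.
Qed.

Lemma control_bound_ge0 : 0 <= M.
Proof. exact: le_trans (enorm_ge0 _) (adm.2 0 (lexx _)). Qed.

(** The trajectory is constant on negative times, where the domain of the
    integral is empty or a point; hence the bound for all real times, and the
    measurability of costs can be read off from continuity on the line. *)
Lemma coord_trajectory_lip s t i :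
  `|y t ord0 i - y s ord0 i| <= M * `|t - s|.
Proof.
wlog st : s t / s <= t => [H|].
  have [/H//|/ltW ts] := leP s t.
  by rewrite distrC [X in _ <= _ * X]distrC; exact: H.
have yE r : y r = y (Num.max 0 r).
  by have [//|/ltW r0] := leP 0 r; rewrite !trajectory_le0.
rewrite yE [y s]yE; apply: le_trans (coord_trajectory_lip0 _ _) _.
  by rewrite le_max lexx/= ge_max le_max lexx/= le_max st orbT.
rewrite ler_wpM2l ?control_bound_ge0// ger0_norm ?subr_ge0//.
by have [s0|s0] := leP 0 s; have [t0|t0] := leP 0 t; lra.
Qed.

Lemma enorm_trajectoryB s t : enorm (y t - y s) <= n%:R * (M * `|t - s|).
Proof.
apply: enorm_le_coord => i; rewrite mxE [(- y s) _ _]mxE.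
exact: coord_trajectory_lip.
Qed.

Lemma continuous_trajectory : continuous y.
Proof.
have M0 := control_bound_ge0.
move=> t; apply/cvg_ballP => e e0.
have e1 : 0 < e / (M + 1) by rewrite divr_gt0// ltr_wpDl.
apply: filterS (nbhsx_ballx t _ e1) => s ts; split => // i j.
rewrite /ball/= (ord1 i); apply: le_lt_trans (coord_trajectory_lip _ _ _) _.
apply: (@le_lt_trans _ _ ((M + 1) * `|t - s|)).
  by rewrite ler_wpM2r// lerDl.
by rewrite mulrC -ltr_pdivlMr// ltr_wpDl.
Qed.

End trajectory.

(** * Costs and halted controls *)

Section running_cost.
Context {R : realType} {n : nat}.
Variables (f : 'rV[R]_n -> R) (C M lambda : R).
Hypothesis cf : continuous f.
Hypothesis fC : forall x, `|f x| <= C.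
Hypothesis lambda_gt0 : 0 < lambda.
Notation mu := (@lebesgue_measure R).
Implicit Types (x : 'rV[R]_n) (alpha : R -> 'rV[R]_n).

Definition running_cost x alpha s : R :=
  (2^-1 * enorm (alpha s) ^+ 2 + f (trajectory x alpha s))
    * expR (- lambda * s).

Definition cost_from x alpha t : R :=
  \int[mu]_(s in `[t, +oo[) running_cost x alpha s.

Lemma measurable_running_cost x alpha : admissible M alpha ->
  measurable_fun (`[0, +oo[ : set R) (running_cost x alpha).
Proof.
move=> adm; apply: measurable_funM; last first.
  apply: measurable_funTS; apply: continuous_measurable_fun.
  exact: continuous_discount.
apply: measurable_funD.
  apply: measurable_funM => //.
  rewrite [X in measurable_fun _ X](_ : _ =
      fun s => \sum_(i < n) alpha s ord0 i ^+ 2); last first.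
    by apply/funext => s; rewrite sqr_enorm.
  by apply: measurable_sum => i; apply: measurable_funX; exact: adm.1.
apply: measurable_funTS; apply: continuous_measurable_fun => s.
by apply: continuous_comp; [exact: continuous_trajectory adm _|exact: cf].
Qed.

Lemma integrable_running_cost x alpha t : admissible M alpha -> 0 <= t ->
  mu.-integrable `[t, +oo[ (EFin \o running_cost x alpha).
Proof.
move=> adm t0; apply: (@integrableS _ _ _ mu `[0, +oo[) => //.
  by apply: subset_itvr; rewrite bnd_simp.
pose B := 2^-1 * M ^+ 2 + C.
have intB := integrable_discount lambda_gt0 0.
apply: (le_integrable _ _ _ (integrableZl _ B intB)) => //.
  by apply/measurable_EFinP; exact: measurable_running_cost adm.
move=> s /=; rewrite in_itv/= andbT => s0; rewrite lee_fin !normrM.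
rewrite ler_wpM2r// (le_trans _ (ler_norm _))//.
apply: le_trans (ler_normD _ _) _; apply: lerD; last exact: fC.
rewrite ger0_norm; last by rewrite mulr_ge0// sqr_ge0.
apply: ler_wpM2l => //.
by rewrite ler_pXn2r ?nnegrE ?enorm_ge0 ?(control_bound_ge0 adm)// adm.2.
Qed.

Lemma cost_from_split x alpha a b : admissible M alpha -> 0 <= a <= b ->
  cost_from x alpha a =
  \int[mu]_(s in `[a, b]) running_cost x alpha s + cost_from x alpha b.
Proof.
move=> adm /andP[a0 ab]; have b0 := le_trans a0 ab.
apply/eqP; rewrite addrC -subr_eq; apply/eqP.
rewrite Rintegral_itvB ?bnd_simp//; last exact: integrable_running_cost.
rewrite Rintegral_itv_obnd_cbnd//.
apply: integrableS (integrable_running_cost x adm b0) => //.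
by apply: subset_itvr; rewrite bnd_simp.
Qed.

(** The competitor from which all upper bounds on optimal costs are derived:
    follow [alpha] up to time [t], then stay. *)
Definition halt alpha (t s : R) : 'rV[R]_n := if s <= t then alpha s else 0.

Lemma admissible_halt alpha t :
  admissible M alpha -> admissible M (halt alpha t).
Proof.
move=> adm; split => [i|s s0]; last first.
  rewrite /halt; case: ifP => _; first exact: adm.2.
  by rewrite enorm0; exact: control_bound_ge0 adm.
rewrite (_ : (fun s => _) =
    (fun s => if s <= t then alpha s ord0 i else 0)); last first.
  by apply/funext => s; rewrite /halt; case: ifP => _//; rewrite mxE.
apply: measurable_fun_if => //.
- exact: measurable_fun_ler.
- exact: measurable_funS (adm.1 i).
Qed.

Lemma trajectory_halt_before x alpha t s : s <= t ->
  trajectory x (halt alpha t) s = trajectory x alpha s.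
Proof.
move=> st; congr (_ + _); apply/rowP => i; rewrite !mxE.
apply: eq_Rintegral => r; rewrite inE/= in_itv/= => /andP[_ rs].
by rewrite /halt (le_trans rs st).
Qed.

Lemma trajectory_halt_after x alpha t s : admissible M alpha -> 0 <= t <= s ->
  trajectory x (halt alpha t) s = trajectory x alpha t.
Proof.
move=> adm ts; rewrite -(trajectory_halt_before x alpha (lexx t)).
apply/rowP => i; apply/eqP.
rewrite -subr_eq0 (trajectoryB x (admissible_halt t adm))//.
apply/eqP; rewrite -[RHS](mul0r (fine (mu `]t, s]))) -Rintegral_cst//.
apply: eq_Rintegral => r; rewrite inE/= in_itv/= => /andP[tr _].
by rewrite /halt leNgt tr/= mxE.
Qed.

Lemma cost_halt x alpha t : admissible M alpha -> 0 <= t ->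
  cost f lambda x (halt alpha t) =
  \int[mu]_(s in `[0, t]) running_cost x alpha s
  + f (trajectory x alpha t) * (expR (- lambda * t) / lambda).
Proof.
move=> adm t0; have admh := admissible_halt t adm.
have before : \int[mu]_(s in `[0, t]) running_cost x (halt alpha t) s =
    \int[mu]_(s in `[0, t]) running_cost x alpha s.
  apply: eq_Rintegral => s; rewrite inE/= in_itv/= => /andP[_ st].
  by rewrite /running_cost trajectory_halt_before// /halt st.
have after : cost_from x (halt alpha t) t =
    f (trajectory x alpha t) * (expR (- lambda * t) / lambda).
  rewrite -(Rintegral_scaled_discount lambda_gt0).
  (* At the time [t] itself the halted control is still [alpha t], hence the
     passage to the open half-line. *)
  have subt : `]t, +oo[ `<=` `[t, +oo[ by apply: subset_itvr; rewrite bnd_simp.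
  rewrite /cost_from -!Rintegral_itv_obnd_cbnd; first last.
  - exact: integrableS (integrable_running_cost x admh t0).
  - by apply: integrableS (integrable_scaled_discount lambda_gt0 _ t).
  apply: eq_Rintegral => s; rewrite inE/= in_itv/= andbT => ts.
  have tts : 0 <= t <= s by rewrite t0 ltW.
  rewrite /running_cost (trajectory_halt_after x adm tts) /halt leNgt ts/=.
  by rewrite enorm0 expr0n mulr0 add0r.
have t00 : 0 <= (0 : R) <= t by apply/andP; split.
by rewrite -before -after; exact: cost_from_split.
Qed.

End running_cost.

(** * A discrete Gronwall inequality *)

(** One step of the hypothesis is one implicit Euler step for
    [H' <= - lambda * H].  With [N] equal steps from [0] to [t] it yields
    [(1 + c / N)^N * H t <= H 0], where [c = lambda * t], and
    [2 * (1 + c / N)^N >= exp c] as soon as [N >= 2 * c^2]. *)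
Lemma implicit_euler_decay {R : realType} (lambda : R) (H : R -> R) t :
  0 < lambda ->
  (forall a b, 0 <= a <= b -> H b * (1 + lambda * (b - a)) <= H a) ->
  0 <= t -> 0 <= H t -> expR (lambda * t) * H t <= 2 * H 0.
Proof.
move=> l0 decay t0 Ht; set c := lambda * t.
have c0 : 0 <= c by rewrite mulr_ge0// ltW.
pose N := (Num.truncn (2 * c ^+ 2)).+1.
have N2 : 2 * c ^+ 2 <= N%:R by rewrite ltW// truncnS_gt.
have N0 : 0 < N%:R :> R by rewrite ltr0n.
pose h := c / N%:R.
have h0 : 0 <= h by rewrite divr_ge0// ltW.
have steps k : (k <= N)%N -> (1 + h) ^+ k * H t <= H (t * (N - k)%:R / N%:R).
  elim: k => [_|k IH kN].
    by rewrite subn0 expr0 mul1r mulfK// gt_eqF.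
  have /le_trans := IH (ltnW kN).
  have kE : (N - k)%:R = (N - k.+1)%:R + 1 :> R by rewrite natr1 subnSK.
  pose a := t * (N - k.+1)%:R / N%:R; pose b := t * (N - k)%:R / N%:R.
  have bE : b = a + t / N%:R by rewrite /b /a kE; field; rewrite gt_eqF.
  have ab : 0 <= a <= b.
    by rewrite bE lerDl /a !divr_ge0 ?mulr_ge0 ?(ltW N0).
  have := decay a b ab; rewrite bE addrAC subrr add0r mulrA -/c -/h -bE => Hab.
  move=> {}IH; rewrite exprS -mulrA; apply: le_trans Hab.
  rewrite mulrC; apply: ler_wpM2r; first by rewrite addr_ge0.
  exact: IH.
have := steps N (leqnn N); rewrite subnn mulr0 mul0r => H0.
suff e2 : expR c <= 2 * (1 + h) ^+ N.
  apply: le_trans (_ : 2 * ((1 + h) ^+ N * H t) <= _).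
    by rewrite mulrA ler_wpM2r.
  by rewrite ler_wpM2l.
have h1 : 0 < 1 + h by rewrite ltr_wpDr.
(* Both bounds come from [1 + u <= exp u] at a negative [u], inverted: used at
   a positive exponent it would bound the exponential from below. *)
have eh : expR (h / (1 + h)) <= 1 + h.
  have := expR_ge1Dx (- (h / (1 + h))).
  have -> : 1 - h / (1 + h) = (1 + h)^-1 by field; rewrite gt_eqF.
  by rewrite expRN lef_pV2 ?posrE ?expR_gt0//.
have ehalf : expR (2^-1) <= 2 :> R.
  have := expR_ge1Dx (- (2^-1 : R)).
  have -> : 1 - 2^-1 = 2^-1 :> R by field.
  by rewrite expRN lef_pV2 ?posrE ?expR_gt0//.
have cE : c <= 2^-1 + h / (1 + h) * N%:R.
  have -> : h / (1 + h) * N%:R = c / (1 + h).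
    by rewrite mulrAC /h divfK// gt_eqF.
  have -> : c / (1 + h) = c - c * h / (1 + h) by field; rewrite gt_eqF.
  suff : c * h / (1 + h) <= 2^-1 by lra.
  rewrite ler_pdivrMr//; apply: (@le_trans _ _ 2^-1); last by lra.
  by rewrite /h mulrA ler_pdivrMr// -expr2; lra.
apply: le_trans (_ : expR (2^-1) * expR (h / (1 + h)) ^+ N <= _).
  by rewrite -expRM_natr -expRD ler_expR.
apply: ler_pM; rewrite ?expR_ge0 ?exprn_ge0 ?expR_ge0//.
by rewrite ler_pXn2r ?nnegrE ?expR_ge0// ltW.
Qed.

(** * The remaining cost along a trajectory *)

Section near_optimal.
Context {R : realType} {n : nat}.
Variables (g : 'rV[R]_n -> R) (K M lambda : R).
Hypothesis cg : continuous g.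
Hypothesis g_ge0 : forall x, 0 <= g x.
Hypothesis gK : forall x, g x <= K.
Hypothesis lambda_gt0 : 0 < lambda.
Notation mu := (@lebesgue_measure R).
Implicit Types (x : 'rV[R]_n) (alpha : R -> 'rV[R]_n).

Let normgK x : `|g x| <= K. Proof. by rewrite ger0_norm. Qed.

Let integrable_itvcc x alpha a b : admissible M alpha -> 0 <= a ->
  mu.-integrable `[a, b] (EFin \o running_cost g lambda x alpha).
Proof.
move=> adm a0.
have inta := integrable_running_cost cg normgK lambda_gt0 x adm a0.
apply: integrableS inta => //.
exact: subset_itvl.
Qed.

Let integrable_cst_itvcc a b (c : R) : mu.-integrable `[a, b] (EFin \o cst c).
Proof.
apply: measurable_bounded_integrable => //; last exact: bounded_cst.
by rewrite /= lebesgue_measure_itv/=; case: ifP => _; rewrite -?EFinB ltry.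
Qed.

Let Rintegral_cst_itvcc a b c : a <= b ->
  \int[mu]_(_ in `[a, b]) c = c * (b - a).
Proof.
move=> ab; rewrite Rintegral_cst//= lebesgue_measure_itv/= lte_fin.
by move: ab; rewrite le_eqVlt => /predU1P[->|->]//=; rewrite ltxx subrr.
Qed.

Let kinetic_ge0 (v : 'rV[R]_n) : 0 <= 2^-1 * enorm v ^+ 2.
Proof. by rewrite mulr_ge0// sqr_ge0. Qed.

Lemma cost_from_ge0 x alpha t : 0 <= cost_from g lambda x alpha t.
Proof.
apply: Rintegral_ge0 => s _; rewrite mulr_ge0 ?expR_ge0//.
by rewrite addr_ge0 ?kinetic_ge0.
Qed.

Lemma cost_from_ge_itv x alpha a b c : admissible M alpha -> 0 <= a <= b ->
  (forall s, a <= s <= b -> c <= running_cost g lambda x alpha s) ->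
  c * (b - a) + cost_from g lambda x alpha b <= cost_from g lambda x alpha a.
Proof.
move=> adm ab cL; have /andP[a0 leab] := ab.
rewrite (cost_from_split cg normgK lambda_gt0 x adm ab) lerD2r.
rewrite -Rintegral_cst_itvcc//; apply: le_Rintegral => //.
- exact: integrable_cst_itvcc.
- exact: integrable_itvcc.
Qed.

Lemma running_cost_ge x alpha s :
  g (trajectory x alpha s) * expR (- lambda * s) <=
  running_cost g lambda x alpha s.
Proof. by rewrite ler_wpM2r ?expR_ge0// lerDr kinetic_ge0. Qed.

Lemma cost_from_nonincreasing x alpha a b : admissible M alpha ->
  0 <= a <= b -> cost_from g lambda x alpha b <= cost_from g lambda x alpha a.
Proof.
move=> adm ab; rewrite -[leLHS]add0r -(mul0r (b - a)).
apply: cost_from_ge_itv => // s _.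
by apply: le_trans (running_cost_ge _ _ _); rewrite mulr_ge0 ?expR_ge0.
Qed.

(** Over the time [h] during which the trajectory stays in the region where
    [g >= gamma], the running cost seen from time [t] is at least
    [gamma * exp (- lambda * h)]. *)
Lemma cost_from_ge_away x alpha gamma t h : admissible M alpha ->
  0 <= t -> 0 <= h -> 0 <= gamma ->
  (forall s, t <= s <= t + h -> gamma <= g (trajectory x alpha s)) ->
  gamma * h * expR (- lambda * h) <=
  expR (lambda * t) * cost_from g lambda x alpha t.
Proof.
move=> adm t0 h0 gamma0 away.
have th : 0 <= t <= t + h by rewrite t0 lerDl.
have := @cost_from_ge_itv x alpha t (t + h)
  (gamma * expR (- lambda * (t + h))) adm th.
rewrite addrAC subrr add0r => H.
rewrite [leRHS]mulrC -ler_pdivrMr ?expR_gt0// -expRN.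
have -> : gamma * h * expR (- lambda * h) * expR (- (lambda * t)) =
    gamma * expR (- lambda * (t + h)) * h.
  have -> : - lambda * (t + h) = - lambda * h + - (lambda * t) by ring.
  by rewrite expRD; ring.
apply: le_trans (H _); first by rewrite lerDl cost_from_ge0.
move=> s /andP[ts sth]; apply: le_trans (running_cost_ge _ _ _).
apply: ler_pM => //; first by apply: away; rewrite ts.
by rewrite ler_expR !mulNr lerN2 ler_wpM2l// ltW.
Qed.

(** Go straight from [x] to the zero [z] of [g] in time [tau], then halt: the
    speed is at most 1, and nothing is paid after the arrival. *)
Lemma small_cost_near_zero x z tau : 1 <= M -> g z = 0 -> 0 < tau ->
  enorm (z - x) <= tau ->
  exists2 beta, admissible M beta & cost g lambda x beta <= tau * (2^-1 + K).
Proof.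
move=> M1 gz tau0 zx; pose v := tau^-1 *: (z - x).
have v1 : enorm v <= 1.
  by rewrite enormZ gtr0_norm ?invr_gt0// mulrC ler_pdivrMr// mul1r.
have admv : admissible M (fun=> v).
  by split => // s _; exact: le_trans v1 M1.
have yv : trajectory x (fun=> v) tau = z.
  apply/rowP => i; rewrite !mxE Rintegral_cst_itvcc ?subr0; last exact: ltW.
  by rewrite mulrAC mulVf ?gt_eqF// mul1r addrC subrK.
exists (halt (fun=> v) tau); first exact: admissible_halt.
rewrite (cost_halt cg normgK lambda_gt0 x admv (ltW tau0)) yv gz mul0r addr0.
rewrite mulrC -[X in _ * X]subr0 -Rintegral_cst_itvcc ?(ltW tau0)//.
apply: le_Rintegral => //; first exact: integrable_itvcc.
  exact: integrable_cst_itvcc.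
move=> s /=; rewrite in_itv/= => /andP[s0 _].
have K0 : 0 <= K by apply: le_trans (g_ge0 x) (gK x).
rewrite /running_cost -[leRHS]mulr1 ler_pM ?expR_ge0//.
- by rewrite addr_ge0 ?kinetic_ge0.
- rewrite lerD// -[leRHS]mulr1 ler_wpM2l// exprn_ile1//; exact: enorm_ge0.
- by rewrite -expR0 ler_expR mulNr oppr_le0 mulr_ge0// ltW.
Qed.

Variables (eps : R) (x : 'rV[R]_n) (alpha : R -> 'rV[R]_n).
Hypothesis adm : admissible M alpha.
Hypothesis opt : forall beta, admissible M beta ->
  cost g lambda x alpha <= cost g lambda x beta + eps.
Let G := cost_from g lambda x alpha.

(** Both the trajectory and its halted version pay the same up to time [t]; the
    halted one pays [g (y t)] at each later time. *)
Lemma cost_from_le_halt t : 0 <= t ->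
  G t <= g (trajectory x alpha t) * (expR (- lambda * t) / lambda) + eps.
Proof.
move=> t0; have := opt (admissible_halt t adm).
rewrite (cost_halt cg normgK lambda_gt0 x adm t0).
have t00 : 0 <= (0 : R) <= t by apply/andP; split.
have := cost_from_split cg normgK lambda_gt0 x adm t00.
rewrite -/(G t) -[cost_from _ _ _ _ 0]/(cost g lambda x alpha) => ->.
by rewrite -addrA lerD2l.
Qed.

(** Integrate from [a] to [b] the inequality [lambda * (G s - eps) <= L s], in
    which [G s >= G b]. *)
Lemma cost_from_decay a b : 0 <= a <= b ->
  (G b - eps) * (1 + lambda * (b - a)) <= G a - eps.
Proof.
move=> ab; have /andP[a0 leab] := ab.
suff : lambda * (G b - eps) * (b - a) + G b <= G a by lra.
apply: cost_from_ge_itv => // s /andP[as_ sb].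
have s0 : 0 <= s := le_trans a0 as_.
apply: le_trans (running_cost_ge _ _ _).
have := cost_from_le_halt s0; rewrite mulrA -lerBlDr ler_pdivlMr// mulrC.
apply: le_trans; rewrite ler_wpM2l ?(ltW lambda_gt0)// lerB//.
by apply: cost_from_nonincreasing; rewrite // s0.
Qed.

(** The Gronwall inequality is applied to [G - eps]; when this is negative at
    time [t], the term [eps * exp (lambda * t)] alone is an upper bound. *)
Lemma discounted_cost_from_le t : 0 <= t -> 0 <= eps ->
  expR (lambda * t) * G t <=
    2 * cost g lambda x alpha + eps * expR (lambda * t).
Proof.
move=> t0 eps0; have e0 := expR_gt0 (lambda * t).
have cost0 : 0 <= cost g lambda x alpha := cost_from_ge0 x alpha 0.
have [Geps|/ltW epsG] := leP (G t) eps.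
  by rewrite mulrC; apply: ler_wpDl; [lra|rewrite ler_wpM2r// ltW].
have Geps0 : 0 <= G t - eps by rewrite subr_ge0.
have := implicit_euler_decay lambda_gt0 cost_from_decay t0 Geps0.
rewrite -[G 0]/(cost g lambda x alpha) mulrBr; lra.
Qed.

End near_optimal.

(** * Stability *)

Section stability.
Context {R : realType} {n : nat}.

(** Let [m] be the lower bound of [cost_from_ge_away] for the cost that remains
    to be paid at distance more than [delta].  Then [eta] is such that the
    optimal cost from [x] is at most [m / 4], and [c] is [m / 8].  That both are
    chosen before [eps] and [t] is what allows a single [eta] for all time
    horizons. *)
Lemma near_optimal_confined (g : 'rV[R]_n -> R)
    (A : set 'rV[R]_n) (K M lambda : R) :
  continuous g -> (forall x, 0 <= g x) -> (forall x, g x <= K) ->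
  1 <= M -> 0 < lambda ->
  A !=set0 -> (forall z, A z -> g z = 0) ->
  (forall delta, 0 < delta -> exists2 gamma, 0 < gamma &
     forall x, delta < dist x A -> gamma <= g x) ->
  forall delta, 0 < delta -> exists eta c, [/\ 0 < eta, 0 < c &
    forall eps x alpha t, 0 <= eps -> admissible M alpha ->
      (forall beta, admissible M beta ->
        cost g lambda x alpha <= cost g lambda x beta + eps) ->
      dist x A <= eta -> 0 <= t -> eps * expR (lambda * t) < c ->
      dist (trajectory x alpha t) A <= delta].
Proof.
move=> cg g0 gK M1 l0 A0 gA sep delta d0.
have d2 : 0 < delta / 2 by rewrite divr_gt0.
have [gamma gamma0 sepd] := sep _ d2.
have K0 : 0 <= K := le_trans (g0 0) (gK 0).
have nM0 : 0 <= n%:R * M by rewrite mulr_ge0// (le_trans _ M1).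
have nM1 : 0 < n%:R * M + 1 by rewrite ltr_wpDl.
(* The trajectory moves by at most [delta / 2] during a time [h]. *)
pose h := delta / 2 / (n%:R * M + 1).
have hE : (n%:R * M + 1) * h = delta / 2 by rewrite mulrC divfK// gt_eqF.
have h0 : 0 < h by rewrite divr_gt0.
pose c := gamma * h * expR (- lambda * h).
have c0 : 0 < c by apply: mulr_gt0; rewrite ?expR_gt0//; exact: mulr_gt0.
pose eta := c / (8 * (2^-1 + K)).
have K2 : 0 < 2^-1 + K by rewrite ltr_wpDr.
have eta0 : 0 < eta by rewrite divr_gt0// mulr_gt0.
exists eta, (c / 8); split; [by []|by rewrite divr_gt0|].
move=> eps x alpha t eps0 adm opt xA t0 epsc.
rewrite leNgt; apply/negP => far.
have lower : c <= expR (lambda * t) * cost_from g lambda x alpha t.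
  apply: (cost_from_ge_away cg g0 gK l0 adm t0 (ltW h0) (ltW gamma0)).
  move=> s /andP[ts sth]; apply: sepd.
  have dist_ts :=
    dist_le_enormB (trajectory x alpha s) (trajectory x alpha t) A0.
  have lip := enorm_trajectoryB x adm t s.
  have : n%:R * (M * `|s - t|) <= delta / 2.
    rewrite mulrA ger0_norm ?subr_ge0//.
    rewrite -hE; apply: ler_pM => //.
    - by rewrite subr_ge0.
    - by rewrite lerDl.
    - by rewrite lerBlDl.
  move=> displacement; rewrite -(ltrD2r (delta / 2)) -splitr.
  apply: lt_le_trans far _; apply: le_trans dist_ts _; rewrite lerD2l.
  exact: le_trans lip displacement.
have tau0 : 0 < 2 * eta by rewrite mulr_gt0.
have xtau : dist x A < 2 * eta by rewrite (le_lt_trans xA)// ltr_pMl// ltr1n.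
have [z Az xz] := dist_lt_ex A0 xtau.
have zx : enorm (z - x) <= 2 * eta by rewrite -opprB enormN ltW.
have [beta admb betac] := small_cost_near_zero cg g0 gK l0 M1 (gA _ Az) tau0 zx.
(* With [u := eps * exp (lambda * t)], the bounds below read
   [c <= 2 * (c / 4 + eps) + u] and [eps <= u < c / 8], which is absurd. *)
have upper := discounted_cost_from_le cg g0 gK l0 adm opt t0 eps0.
have e1 : 1 <= expR (lambda * t).
  by rewrite -expR0 ler_expR mulr_ge0// ltW.
have epse : eps <= eps * expR (lambda * t) by rewrite ler_peMr.
have etac : 2 * eta * (2^-1 + K) = c / 4.
  by rewrite /eta; move: (2^-1 + K) K2 => k k0; field; rewrite gt_eqF.
move: c0 epsc epse betac lower upper (opt _ admb); rewrite etac.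
move: (c) (cost _ _ _ beta) (cost _ _ _ alpha) (eps * _).
move: (_ * cost_from _ _ _ _ _).
by clear => ct c cb ca u *; lra.
Qed.

Lemma cost_shift (f : 'rV[R]_n -> R) (C M lambda a : R) x alpha :
  continuous f -> (forall x, `|f x| <= C) -> 0 < lambda ->
  admissible M alpha ->
  cost (fun y => f y - a) lambda x alpha = cost f lambda x alpha - a / lambda.
Proof.
move=> cf fC l0 adm.
have -> : a / lambda =
    \int[lebesgue_measure]_(s in `[0, +oo[) (a * expR (- lambda * s)).
  by rewrite Rintegral_scaled_discount// mulr0 expR0 mul1r.
rewrite -RintegralB//; first last.
- exact: integrable_scaled_discount.
- exact: (integrable_running_cost cf fC l0 x adm (lexx 0)).
by apply: eq_Rintegral => s _; rewrite addrA mulrBl.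
Qed.

(** The costs for [f] are all at least [a / lambda], so that their infimum is
    indeed a lower bound. *)
Lemma eps_optimal_excess (f : 'rV[R]_n -> R) (C M lambda a eps : R) x alpha :
  continuous f -> (forall x, `|f x| <= C) -> 0 < lambda ->
  (forall y, a <= f y) -> eps_optimal f M lambda eps x alpha ->
  forall beta, admissible M beta ->
    cost (fun y => f y - a) lambda x alpha <=
    cost (fun y => f y - a) lambda x beta + eps.
Proof.
move=> cf fC l0 af [adm opt] beta admb.
rewrite !(@cost_shift f C M)// addrAC lerD2r (le_trans opt)// lerD2r.
apply: ge_inf; last by exists beta.
exists (a / lambda) => _ [b admb' <-].
rewrite -subr_ge0 -(cost_shift a x cf fC l0 admb').
by apply: (@cost_from_ge0 _ _ (fun y => f y - a)) => y; rewrite subr_ge0.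
Qed.

End stability.

Unset Implicit Arguments.

(* For a fixed eps > 0 nothing constrains an eps-optimal trajectory after the
   times s with exp (- lambda * s) of order eps, so "eps small" is relative to
   the time horizon T, which is arbitrary; eta depends neither on T nor on
   eps.  Optimal trajectories are controlled for all times. *)
Theorem theorem4p4 (R : realType) (n : nat) (f : 'rV[R]_n -> R) (M lambda : R) :
  continuous f ->
  (exists C : R, forall x, `|f x| <= C) ->
  minimizers f !=set0 ->
  well_separated f ->
  1 + Num.sqrt (6 * sup_norm f) <= M ->
  0 < lambda ->
  (forall delta : R, 0 < delta -> exists2 eta : R, 0 < eta &
     forall T : R, 0 < T -> exists2 eps0 : R, 0 < eps0 &
       forall eps : R, 0 < eps <= eps0 ->
       forall (x : 'rV[R]_n) (alpha : R -> 'rV[R]_n),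
         eps_optimal f M lambda eps x alpha ->
         dist x (minimizers f) <= eta ->
         forall s : R, 0 < s <= T ->
           dist (trajectory x alpha s) (minimizers f) <= delta)
  /\
  (forall delta : R, 0 < delta -> exists2 eta : R, 0 < eta &
     forall (x : 'rV[R]_n) (alpha : R -> 'rV[R]_n),
       optimal f M lambda x alpha ->
       dist x (minimizers f) <= eta ->
       forall s : R, 0 < s ->
         dist (trajectory x alpha s) (minimizers f) <= delta).
Proof.
move=> cf [C fC] min0 sep MM l0.
have M1 : 1 <= M by apply: le_trans MM; rewrite lerDl sqrtr_ge0.
have fmin_le y : fmin f <= f y.
  apply: ge_inf; last by exists y.
  by exists (- C) => _ [z _ <-]; have := fC z; rewrite ler_norml => /andP[].
have cg : continuous (fun y => f y - fmin f).
  by move=> y; apply: (cvgB (cf y)); exact: cvg_cst.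
have g_ge0 y : 0 <= f y - fmin f by rewrite subr_ge0.
have g_le y : f y - fmin f <= C - fmin f.
  by rewrite lerD2r (le_trans (ler_norm _)).
have g_min y : minimizers f y -> f y - fmin f = 0 by move=> ->; rewrite subrr.
have g_away d : 0 < d -> exists2 gamma, 0 < gamma &
    forall y, d < dist y (minimizers f) -> gamma <= f y - fmin f.
  move=> /sep[gamma gamma0 gammaf]; exists gamma => // y dy.
  rewrite -lee_fin; apply: le_trans (ltW gammaf) _.
  by apply: ereal_inf_lbound; exists y.
have stable delta : 0 < delta -> exists eta c, [/\ 0 < eta, 0 < c &
    forall eps x alpha t, 0 <= eps -> eps_optimal f M lambda eps x alpha ->
      dist x (minimizers f) <= eta -> 0 <= t -> eps * expR (lambda * t) < c ->
      dist (trajectory x alpha t) (minimizers f) <= delta].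
  move=> d0; have [eta [c [eta0 c0 H]]] :=
    near_optimal_confined cg g_ge0 g_le M1 l0 min0 g_min g_away d0.
  exists eta, c; split => // eps x alpha t eps0 opt.
  apply: (H eps) => //; first exact: opt.1.
  exact: (eps_optimal_excess cf fC l0 fmin_le opt).
split=> delta d0; have [eta [c [eta0 c0 H]]] := stable _ d0.
  exists eta => // T T0; exists (c / 2 * expR (- (lambda * T))).
    by rewrite mulr_gt0 ?expR_gt0// divr_gt0.
  move=> eps /andP[eps0 epsc] x alpha opt xA s /andP[s0 sT].
  apply: H (ltW eps0) opt xA (ltW s0) _.
  apply: le_lt_trans (_ : c / 2 < c); last by lra.
  rewrite -ler_pdivlMr ?expR_gt0// -expRN (le_trans epsc)//.
  by rewrite ler_pM2l ?divr_gt0// ler_expR lerN2 ler_pM2l.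
exists eta => // x alpha opt xA s s0.
by apply: H (lexx 0) opt xA (ltW s0) _; rewrite mul0r.
Qed.
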